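(* Let $G$ be a countable amenable group. Let $(X,T)$ and $(Y,S)$ be $G$-subshifts with a factor map $\pi : X \to Y$. Let $\mathcal{H}_{sub}^{\pi}(X,Y)$ denote the set of numbers $r \in \mathbb{R}$ such that there exist a $G$-subshift $(Z,R)$ with $h(Z,R) = r$ and factor maps $\varphi : X \to Z$ and $\psi : Z \to Y$ such that $\pi = \psi \circ \varphi$. Then $\mathcal{H}_{sub}^{\pi}(X,Y)$ is dense in the interval $[h(Y,S),h(X,T)]$.
   Context: For a finite alphabet $\mathcal{A}$, the full shift $\mathcal{A}^G$ carries the product topology (with $\mathcal{A}$ discrete) and the shift action $\sigma=(\sigma^g)_{g\in G}$, $(\sigma^g(x))(h) = x(hg)$. A $G$-subshift is a closed $\sigma$-invariant subset $X\subset\mathcal{A}^G$ for some finite alphabet $\mathcal{A}$ (the alphabet may vary from subshift to subshift), together with the restricted action $T=\sigma|_X$. A factor map is a continuous surjection commuting with the actions. A Følner sequence is a sequence $\{F_n\}$ of finite subsets of $G$ with $|KF_n\,\triangle\,F_n|/|F_n|\to 0$ for each finite $K\subset G$. $h(X,T)$ is topological entropy: $h(X,T)=\sup_{\mathcal U}\lim_n \frac{1}{|F_n|}\log N\bigl(\bigvee_{g\in F_n}T^{g^{-1}}\mathcal{U}\bigr)$, where the supremum is over finite open covers $\mathcal{U}$ of $X$, $N(\cdot)$ is the minimal cardinality of a subcover, and $\{F_n\}$ is a Følner sequence (the limit exists and does not depend on the choice of sequence).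
   Formalization: The group G is taken to be countably infinite: for finite G the claim fails (G trivial, X two points, Y one point gives the set {0, log 2}, not dense in [0, log 2]). *)

(* Defs.v *)
From mathcomp Require Export all_boot all_order all_algebra.
From mathcomp Require Export finmap.
From mathcomp Require Export all_classical all_reals all_analysis.
Export numFieldNormedType.Exports.

Set Implicit Arguments.
Unset Strict Implicit.
Unset Printing Implicit Defensive.

Import Order.TTheory GRing.Theory Num.Theory.

Local Open Scope classical_set_scope.
Local Open Scope ring_scope.

Definition full_shift (G : groupType) (A : finType) : topologicalType :=
  prod_topology (fun _ : G => discrete_topology A).

Definition shift (G : groupType) (A : finType) (g : G) (x : full_shift G A) :
  full_shift G A := fun h => x (h * g)%g.

Definition subshift (G : groupType) (A : finType) (X : set (full_shift G A)) :=
  closed X /\ forall g x, X x -> X (shift g x).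

(* A map from X to Y is represented by a function between the ambient full
   shifts, of which only the values on X matter. *)
Definition factor_map (G : groupType) (A B : finType)
    (X : set (full_shift G A)) (Y : set (full_shift G B))
    (f : full_shift G A -> full_shift G B) :=
  [/\ {within X, continuous f},
      f @` X = Y
    & forall g x, X x -> f (shift g x) = shift g (f x)].

(* A countable group is amenable exactly when it has such a sequence.
   The sets F n are required to be nonempty because x / 0 = 0 in R: a sequence
   of empty sets would otherwise qualify. *)
Definition folner (R : realType) (G : groupType) (F : nat -> {fset G}) :=
  (forall n, F n != fset0) /\
  forall K : {fset G},
    let KF n := [fset (k * f)%g | k in K, f in F n]%fset in
    (#|` (KF n `\` F n) `|` (F n `\` KF n) |%fset%:R / #|` F n|%:R : R)
      @[n --> \oo] --> (0 : R).

Definition finite_open_cover (G : groupType) (A : finType)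
    (X : set (full_shift G A)) (U : set (set (full_shift G A))) :=
  [/\ finite_set U,
      forall u, U u -> exists2 O, open O & u = X `&` O
    & \bigcup_(u in U) u = X].

Definition subcover_size (T : Type) (X : set T) (U : set (set T)) : set nat :=
  [set k | exists V, [/\ V `<=` U, X `<=` \bigcup_(v in V) v
                       & (V #= `I_k)%card]].

Definition min_subcover (T : Type) (X : set T) (U : set (set T)) : nat :=
  xget 0%N [set k | subcover_size X U k /\
                    forall m, subcover_size X U m -> (k <= m)%N].

Definition cover_join (T : Type) (G : groupType) (F : {fset G})
    (W : G -> set (set T)) : set (set T) :=
  [set \bigcap_(g in [set` F]) u g
    | u in [set u : G -> set T | forall g, g \in F -> W g (u g)]].

Definition shift_cover (G : groupType) (A : finType) (g : G)
    (U : set (set (full_shift G A))) : set (set (full_shift G A)) :=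
  [set shift g @` u | u in U].

Definition entropy (R : realType) (G : groupType) (F : nat -> {fset G})
    (A : finType) (X : set (full_shift G A)) : \bar R :=
  ereal_sup
    [set (lim ((ln (min_subcover X
                      (cover_join (F n) (fun g => shift_cover g^-1%g U)))%:R
                / #|` F n|%:R : R) @[n --> \oo]))%:E
      | U in finite_open_cover X].

Definition intermediate_entropies (R : realType) (G : groupType)
    (F : nat -> {fset G}) (A B : finType)
    (X : set (full_shift G A)) (Y : set (full_shift G B))
    (pi : full_shift G A -> full_shift G B) : set R :=
  [set r | exists (C : finType) (Z : set (full_shift G C))
             (phi : full_shift G A -> full_shift G C)
             (psi : full_shift G C -> full_shift G B),
     [/\ subshift Z,
         entropy R F Z = r%:E,
         factor_map X Z phi,
         factor_map Z Y psi
       & forall x, X x -> pi x = psi (phi x)]].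

(* Main.v *)
Require Import Defs.
From mathcomp Require Import lra.

Set Implicit Arguments.
Unset Strict Implicit.
Unset Printing Implicit Defensive.

Import Order.TTheory GRing.Theory Num.Theory.

Local Open Scope classical_set_scope.
Local Open Scope ring_scope.

(* Shearer's inequality for pattern counts gives
   N(F)^|Q| <= N(Q)^|Q^-1 F|, hence log N(F_n) / |F_n| converges to its infimum
   for every Foelner sequence and no tiling argument is needed. This number is
   the entropy of the subshift.

   For a clopen set D of X let Z_D be the factor of X that records pi(x) and,
   at each site g with shift g x not in D, also the symbol x(g). Then Z_D is
   conjugate to X for D empty and to Y for D = X, so it suffices to enlarge D
   from empty to X by steps that cost less than e each. Two kinds of steps are
   used.

   First, for each set S of M elements of K K^-1, the points that look
   S-periodic through a window L, where L is much larger than the window of the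
   current D, are added to D. On each translate of S the newly hidden symbols
   are then all equal, so by Shearer's inequality, conditional on the new
   factor, the step costs at most log(|A| + 1) / M.

   Then the cylinders over a large window are added to D one by one. If a
   cylinder, outside of the current D, were visited M times in a translate of
   K, then the point would be S-periodic there for some S as above, hence
   already in D. So the newly hidden sites meet each translate of K less than M
   times, and the step costs at most M log(|K| + 1) / |K|, which is small for
   |K| large since G is infinite. *)

(** * Counting values; Shearer's inequality *)

(** Its logarithm plays the role of an entropy; [leq_nval_pair] is then the chain rule, with the
    worst conditional count. *)
Definition nval (T : Type) (S : finType) (X : set T) (a : T -> S) : nat :=
  #|[pred s | `[< exists2 x, X x & a x = s >]]|.

(** Sending each value of [a] to the value of [b] at a related point is injective by the second
    hypothesis. A relation lets the two maps live on different spaces. *)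
Lemma leq_nval (T T' : Type) (S S' : finType) (X : set T) (Y : set T')
    (a : T -> S) (b : T' -> S') (r : T -> T' -> Prop) :
  (forall x, X x -> exists2 y, Y y & r x y) ->
  (forall x x' y y', X x -> X x' -> Y y -> Y y' -> r x y -> r x' y' ->
     b y = b y' -> a x = a x') ->
  (nval X a <= nval Y b)%N.
Proof.
move=> tot det.
have [[x0 /tot [y0 _ _]]|X0] := pselect (exists x, X x); last first.
  rewrite /nval eq_card0 // => s; rewrite !inE.
  by apply/negbTE/asboolP => -[x Xx _]; apply: X0; exists x.
have /choice [h hP] (s : S) : exists s' : S', (exists2 x, X x & a x = s) ->
    exists x y, [/\ X x, a x = s, Y y, r x y & b y = s'].
  have [[x Xx axs]|nex] := pselect (exists2 x, X x & a x = s).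
    by have [y Yy rxy] := tot x Xx; exists (b y) => _; exists x, y.
  by exists (b y0).
rewrite /nval -(@card_in_image _ _ h).
  apply/subset_leq_card/fintype.subsetP => s' /mapP[s]; rewrite mem_enum !inE.
  move=> sX ->; have [x [y [_ _ Yy _ <-]]] := hP _ sX.
  by exists y.
move=> s t; rewrite !inE => sX tX hst.
have [x [y [Xx axs Yy rxy bs]]] := hP _ sX.
have [x' [y' [Xx' axt Yy' rxy' bt]]] := hP _ tX.
rewrite -axs -axt; apply: (det _ _ _ _ Xx Xx' Yy Yy' rxy rxy').
by rewrite bs hst bt.
Qed.

Lemma leq_nval_det (T : Type) (S S' : finType) (X Y : set T)
    (a : T -> S) (b : T -> S') :
  X `<=` Y -> (forall x y, X x -> X y -> b x = b y -> a x = a y) ->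
  (nval X a <= nval Y b)%N.
Proof.
move=> XY det; apply: (leq_nval (r := fun x y => x = y)) => [x Xx|].
  by exists x => //; apply: XY.
by move=> x x' y y' Xx Xx' _ _ <- <-; apply: det.
Qed.

Lemma nval_gt0 (T : Type) (S : finType) (X : set T) (a : T -> S) (x : T) :
  X x -> (0 < nval X a)%N.
Proof.
move=> Xx; apply/card_gt0P; exists (a x); rewrite inE.
by exists x.
Qed.

Lemma leq_nval_sum (T : Type) (S C : finType) (X : set T)
    (a : T -> S) (e : T -> C) :
  (nval X a <= \sum_(c : C) nval (X `&` [set x | e x = c]) a)%N.
Proof.
rewrite {1}/nval -sum1_card.
apply: (@leq_trans (\sum_(s | `[< exists2 x, X x & a x = s >])
   \sum_(c : C) `[< exists2 x, X x /\ e x = c & a x = s >])%N).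
  apply: leq_sum => s /asboolW [x Xx axs].
  rewrite (bigD1 (e x)) //= (_ : `[< _ >] = true) //.
  by apply/asboolP; exists x.
rewrite exchange_big; apply: leq_sum => c _ /=.
rewrite /nval -sum1_card big_mkcond [leqRHS]big_mkcond /=.
by apply: leq_sum => s _; rewrite !inE; do 2 case: ifP => //=; case: `[< _ >].
Qed.

Lemma nval_sum_leq (T : Type) (S C : finType) (X : set T)
    (a : T -> S) (e : T -> C) :
  (forall x y, X x -> X y -> a x = a y -> e x = e y) ->
  (\sum_(c : C) nval (X `&` [set x | e x = c]) a <= nval X a)%N.
Proof.
move=> det; rewrite {2}/nval -sum1_card.
apply: (@leq_trans (\sum_(s | `[< exists2 x, X x & a x = s >])
   \sum_(c : C) `[< exists2 x, X x /\ e x = c & a x = s >])%N); last first.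
  apply: leq_sum => s /asboolP [x Xx axs].
  rewrite (bigD1 (e x)) //= big1 ?addn0 ?leq_b1// => c cx.
  rewrite (_ : `[< _ >] = false) //; apply/negbTE/asboolP => -[y [Xy eyc] ays].
  by move: cx; rewrite -eyc (det x y) ?eqxx// axs.
rewrite exchange_big; apply: leq_sum => c _ /=.
rewrite /nval -sum1_card big_mkcond [leqRHS]big_mkcond /=.
apply: leq_sum => s _; rewrite !inE.
case: asboolP => // -[x [Xx exc] axs].
by case: asboolP => // -[]; exists x.
Qed.

Lemma leq_nval_pair (T : Type) (S C : finType) (X : set T)
    (a : T -> S) (b : T -> C) (m : nat) :
  (forall s, nval (X `&` [set x | a x = s]) b <= m)%N ->
  (nval X (fun x => (a x, b x)) <= nval X a * m)%N.
Proof.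
move=> hm; apply: leq_trans (leq_nval_sum _ _ a) _.
rewrite {1}/nval -sum_nat_const [leqRHS]big_mkcond /=.
apply: leq_sum => s _; rewrite !inE; case: asboolP => [_|nex].
  apply: leq_trans (hm s); apply: leq_nval_det => // x y [_ <-] [_ ->] -> //.
rewrite /nval eq_card0 // => p; rewrite !inE.
by apply/negbTE/asboolP => -[x [Xx axs] _]; apply: nex; exists x.
Qed.

Lemma nval_leq_card (T : Type) (S U : finType) (X : set T) (a : T -> S)
    (f : U -> S) :
  (forall x, X x -> exists u, a x = f u) -> (nval X a <= #|U|)%N.
Proof.
move=> h; rewrite -cardsT; apply: leq_trans (leq_imset_card f _).
apply/subset_leq_card/fintype.subsetP => s; rewrite inE => -[x Xx <-].
by have [u ->] := h x Xx; apply/imsetP; exists u.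
Qed.

(* Dividing by the t with t ^ #|J| equal to the right-hand side reduces this form
   of Hoelder's inequality to AM-GM, summed over a. *)
Lemma holder_prod (R : realType) (A I : finType) (J : pred I)
    (c : A -> I -> R) (s : A -> R) (kap : R) :
  (0 < #|J|)%N -> 0 <= kap -> (forall a, 0 <= s a) ->
  (forall a i, 0 <= c a i) ->
  (forall a, s a ^+ #|J| <= kap * \prod_(i in J) c a i) ->
  (\sum_a s a) ^+ #|J| <= kap * \prod_(i in J) \sum_a c a i.
Proof.
move=> J0 kap0 s0 c0 hs; set k := #|J|.
have k0 : 0 < k%:R :> R by rewrite ltr0n.
pose Cs i := \sum_a c a i.
have Cs0 i : 0 <= Cs i by apply: sumr_ge0.
set P := kap * _.
have P0 : 0 <= P by rewrite mulr_ge0// prodr_ge0// => i _; apply: Cs0.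
have sP a : s a ^+ k <= P.
  apply: le_trans (hs a) _; rewrite ler_wpM2l// ler_prod// => i _.
  by rewrite c0/= /Cs (bigD1 a)//= lerDl sumr_ge0.
have [P00|PN0] := eqVneq P 0.
  rewrite big1 ?P00 ?expr0n ?eqn0Ngt ?J0// => a _.
  have := sP a; rewrite P00 => /(conj (exprn_ge0 k (s0 a)))/andP/le_anti/esym.
  by move=> /eqP; rewrite expf_eq0 => /andP[_ /eqP].
have Ppos : 0 < P by rewrite lt_def PN0.
have kapN0 : kap != 0 by apply: contraNN PN0 => /eqP h; rewrite /P h mul0r.
have CN0 i : i \in J -> Cs i != 0.
  move=> iJ; apply: contraNN PN0 => /eqP h.
  by rewrite /P (bigD1 i)//= -/(Cs i) h mul0r mulr0.
pose t := expR (ln P / k%:R).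
have tk : t ^+ k = P.
  by rewrite -expRM_natl mulrC divfK ?gt_eqF// lnK// posrE.
have t0 : 0 < t by rewrite expR_gt0.
suff : \sum_a s a <= t by rewrite -tk => h; rewrite lerXn2r ?nnegrE ?sumr_ge0// ltW.
have key a : s a / t <= (\sum_(i in J) c a i / Cs i) / k%:R.
  have S0 : 0 <= \sum_(i in J) c a i / Cs i.
    by apply: sumr_ge0 => i _; rewrite divr_ge0.
  rewrite -(@ler_pXn2r _ k) ?nnegrE ?divr_ge0 ?(ltW t0) ?(ltW k0)//.
  apply: le_trans (_ : \prod_(i in J) (c a i / Cs i) <= _); last first.
    by have [] := leif_AGM (A := J) (E := fun i => c a i / Cs i)
      (fun i _ => divr_ge0 (c0 a i) (Cs0 i)).
  rewrite expr_div_n tk ler_pdivrMr// big_split/= /P.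
  rewrite -[X in _ <= _ * _ * X]/(kap * \prod_(i in J) Cs i).
  rewrite mulrCA -mulrA prodfV mulVf; last by apply/prodf_neq0 => i iJ; apply: CN0.
  by rewrite mulr1.
have : \sum_a (s a / t) <= 1.
  apply: le_trans (ler_sum _ (fun a _ => key a)) _.
  rewrite -mulr_suml exchange_big/=.
  rewrite (eq_bigr (fun=> 1)); last first.
    by move=> i iJ; rewrite -mulr_suml divff// CN0.
  by rewrite sumr_const divff// gt_eqF.
by rewrite -mulr_suml ler_pdivrMr// mul1r.
Qed.

(** Induction over the coordinates: the value [c] of [a x j] splits [X] into classes, and the bounds
    for the classes are summed by Hoelder's inequality with exponent [k], the number of windows
    containing [j]. *)
Lemma shearer (R : realType) (T : Type) (J I C : finType) (X : set T)
    (a : T -> J -> C) (W : I -> pred J) (k : nat) :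
  (0 < k)%N -> (forall j, #|[pred i | W i j]| = k) ->
  (nval X (fun x => [ffun j => a x j]) ^ k <=
   \prod_i nval X (fun x => [ffun j => if W i j then Some (a x j) else None]))%N.
Proof.
move=> k0 Wk.
pose full x := [ffun j => a x j].
pose proj i x := [ffun j => if W i j then Some (a x j) else None].
(* [D] lists the coordinates that may still vary on [X]. *)
suff main (D : seq J) : forall X : set T,
    (forall x y j, X x -> X y -> j \notin D -> a x j = a y j) ->
    (nval X full ^ k <= \prod_i nval X (proj i))%N.
  by apply: (main (enum J)) => x y j _ _; rewrite mem_enum.
elim: D => [|j D IH] {}X detX.
  have [[x0 Xx0]|X0] := pselect (exists x, X x); last first.
    rewrite (_ : nval X full = 0%N) ?exp0n//.
    rewrite /nval eq_card0 // => s; rewrite !inE.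
    by apply/negbTE/asboolP => -[x Xx _]; apply: X0; exists x.
  apply: (@leq_trans 1%N).
    rewrite -(exp1n k) leq_exp2r// -card_unit.
    apply: (nval_leq_card (f := fun=> full x0)) => x Xx; exists tt.
    by apply/ffunP => j; rewrite !ffunE; apply: detX.
  by apply: prodn_gt0 => i; apply: (nval_gt0 _ Xx0).
pose Xc c := X `&` [set x | a x j = c].
have IHc c : (nval (Xc c) full ^ k <= \prod_i nval (Xc c) (proj i))%N.
  apply: IH => x y i [Xx xc] [Xy yc] iD.
  have [->|ij] := eqVneq i j; first by rewrite xc yc.
  by apply: detX => //; rewrite inE (negbTE ij).
have splitI (f : I -> nat) : (\prod_i f i =
    \prod_(i | ~~ W i j) f i * \prod_(i | W i j) f i)%N.
  by rewrite [LHS](bigID (fun i => W i j))/= mulnC.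
(* Windows missing [j] are bounded by their count on all of [X] and form the constant; the [k]
   windows containing [j] determine [c], so their counts add up over the classes. *)
rewrite -(ler_nat R) natrX splitI natrM.
have := @holder_prod R C I [pred i | W i j]
  (fun c i => (nval (Xc c) (proj i))%:R) (fun c => (nval (Xc c) full)%:R)
  (\prod_(i | ~~ W i j) nval X (proj i))%N%:R.
rewrite Wk => /(_ k0 (ler0n _ _) (fun=> ler0n _ _) (fun _ _ => ler0n _ _)) H.
apply: le_trans (le_trans (H _) _).
- rewrite lerXn2r ?nnegrE ?ler0n ?sumr_ge0// -natr_sum ler_nat.
  exact: leq_nval_sum.
- move=> c; rewrite -natrX -natr_prod -natrM ler_nat.
  apply: leq_trans (IHc c) _; rewrite splitI leq_mul2r; apply/orP; right.
  by apply: leq_prod => i _; apply: leq_nval_det => [x []//|x y _ _ ->].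
- rewrite ler_wpM2l// natr_prod ler_prod// => i Wij.
  rewrite sumr_ge0//= -natr_sum ler_nat; apply: nval_sum_leq => x y Xx Xy.
  move=> /ffunP/(_ j); rewrite !ffunE.
  by rewrite -[W i j]/(i \in [pred i | W i j]) Wij => -[].
Qed.

(** * Pattern counts along a Foelner sequence *)

Definition pat (G : groupType) (C : Type) (F : {fset G}) (x : G -> C) :
  {ffun F -> C} := [ffun i : F => x (val i)].

Definition agree (G : groupType) (C : Type) (K : {fset G}) (x y : G -> C) :=
  forall k, k \in K -> x k = y k.

Lemma pat_eqP (G : groupType) (C : Type) (F : {fset G}) (x y : G -> C) :
  pat F x = pat F y <-> agree F x y.
Proof.
split=> [/ffunP h k kF|h]; first by have := h [`kF]%fset; rewrite !ffunE.
by apply/ffunP => k; rewrite !ffunE; apply: h; apply: valP.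
Qed.

Definition mulfs (G : groupType) (K F : {fset G}) : {fset G} :=
  [fset (k * f)%g | k in K, f in F]%fset.

Lemma mem_mulfs (G : groupType) (K F : {fset G}) k f :
  k \in K -> f \in F -> (k * f)%g \in mulfs K F.
Proof. by move=> kK fF; apply/imfset2P; exists k => //; exists f. Qed.

Definition invfs (G : groupType) (K : {fset G}) : {fset G} :=
  [fset (k^-1)%g | k in K]%fset.

Lemma mem_invfs (G : groupType) (K : {fset G}) k :
  k \in K -> (k^-1)%g \in invfs K.
Proof. by move=> kK; apply/imfsetP; exists k. Qed.

(** [None] marks the sites outside [P], so that the type of the pattern does not depend on [P]. *)
Definition mask (G : groupType) (C : Type) (F : {fset G}) (P : pred G)
  (x : G -> C) : {ffun F -> option C} :=
  [ffun i : F => if P (val i) then Some (x (val i)) else None].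

(** The windows are the translates of [Q] by the elements of Q^-1 F. A site [j] lies in the
    translate by [i] exactly when [i] is in Q^-1 j, so it is covered |Q| times. *)
Lemma shearer_group (R : realType) (G : groupType) (T : Type) (C : finType)
    (X : set T) (a : T -> G -> C) (F Q : {fset G}) (m : nat) :
  Q != fset0 ->
  (forall g, nval X (fun x => mask F [pred w | (w * g^-1)%g \in Q] (a x)) <= m)%N ->
  (nval X (fun x => pat F (a x)) ^ #|`Q| <= m ^ #|`mulfs (invfs Q) F|)%N.
Proof.
move=> Q0 hm; set I := mulfs (invfs Q) F.
pose W (i : I) (j : F) := (val j * (val i)^-1)%g \in Q.
have Wk j : #|[pred i | W i j]| = #|`Q|.
  have qI (q : Q) : ((val q)^-1 * val j)%g \in I.
    by apply: mem_mulfs; rewrite ?mem_invfs// fsvalP.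
  pose h (q : Q) : I := [` qI q]%fset.
  have hi : injective h.
    move=> p q /(congr1 val)/= /mulIg/invg_inj pq; exact: val_inj.
  rewrite cardfE -(fintype.card_image hi); apply: eq_card => i; rewrite !inE /W.
  apply/idP/fintype.imageP => [iQ|[q _ ->]]/=.
    by exists [` iQ]%fset => //; apply: val_inj; rewrite /= invgM invgK mulgVK.
  by rewrite invgM invgK mulVKg fsvalP.
have kgt0 : (0 < #|`Q|)%N by rewrite cardfs_gt0.
apply: leq_trans (@shearer R T F I C X (fun x j => a x (val j)) W _ kgt0 Wk) _.
rewrite [#|`I|]cardfE -prod_nat_const; apply: leq_prod => i _.
exact: (hm (val i)).
Qed.

Definition npat (G : groupType) (C : finType) (Z : set (full_shift G C))
  (F : {fset G}) : nat := nval Z (pat F).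

(** Shifting by [g] moves each window into [Q], so by invariance it shows at most [npat Z Q]
    values. *)
Lemma npat_shearer (R : realType) (G : groupType) (C : finType)
    (Z : set (full_shift G C)) (F Q : {fset G}) :
  (forall g x, Z x -> Z (shift g x)) -> Q != fset0 ->
  (npat Z F ^ #|`Q| <= npat Z Q ^ #|`mulfs (invfs Q) F|)%N.
Proof.
move=> sZ Q0; apply: (@shearer_group R G _ C Z (fun x => x)) => // g.
apply: (leq_nval (r := fun x y : full_shift G C => y = shift g x)).
  by move=> x Zx; exists (shift g x) => //; apply: sZ.
move=> x x' _ _ _ _ _ _ -> -> /pat_eqP h; apply/ffunP => j; rewrite !ffunE/=.
by case: ifP => // jQ; have := h _ jQ; rewrite /shift mulgVK => ->.
Qed.

(** As [ln] is 0 at 0, the bounds below also hold at 0, which covers empty subshifts. *)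
Definition lnn (R : realType) (n : nat) : R := ln (n%:R : R).

Lemma lnn_ge0 (R : realType) n : 0 <= lnn R n.
Proof.
by case: n => [|n]; rewrite /lnn; [rewrite ln0 | rewrite ln_ge0// ler1n].
Qed.

Lemma ler_lnn (R : realType) m n : (m <= n)%N -> lnn R m <= lnn R n.
Proof.
case: m => [_|m mn]; first by rewrite {1}/lnn ln0 ?lnn_ge0.
by rewrite ler_ln ?posrE ?ltr0n ?ler_nat// (leq_trans _ mn).
Qed.

Lemma lnnX (R : realType) m n : lnn R (m ^ n) = n%:R * lnn R m.
Proof.
case: m => [|m]; last by rewrite /lnn natrX lnXn ?ltr0n// mulr_natl.
have l0 : lnn R 0%N = 0 by rewrite /lnn ln0.
by case: n => [|n]; [rewrite mul0r /lnn ln1|rewrite exp0n// l0 mulr0].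
Qed.

Lemma lnnM (R : realType) m n : lnn R (m * n) <= lnn R m + lnn R n.
Proof.
case: m => [|m]; first by rewrite mul0n {1}/lnn ln0// addr_ge0 ?lnn_ge0.
case: n => [|n]; first by rewrite muln0 {1}/lnn ln0// addr_ge0 ?lnn_ge0.
by rewrite /lnn natrM lnM ?posrE ?ltr0n.
Qed.

Definition rate (R : realType) (G : groupType) (C : finType)
  (Z : set (full_shift G C)) (F : {fset G}) : R :=
  lnn R (npat Z F) / #|`F|%:R.

Definition bdry (R : realType) (G : groupType) (K F : {fset G}) : R :=
  #|`(mulfs K F `\` F)%fset|%:R / #|`F|%:R.

Lemma bdry_ge0 (R : realType) (G : groupType) (K F : {fset G}) : 0 <= bdry R K F.
Proof. by rewrite divr_ge0. Qed.

Lemma rate_ge0 (R : realType) (G : groupType) (C : finType)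
  (Z : set (full_shift G C)) (F : {fset G}) : 0 <= rate R Z F.
Proof. by rewrite divr_ge0 ?lnn_ge0. Qed.

Lemma mulfs_ratio (R : realType) (G : groupType) (K F : {fset G}) :
  F != fset0 -> #|`mulfs K F|%:R / #|`F|%:R <= 1 + bdry R K F.
Proof.
move=> F0; have Fgt0 : 0 < #|`F|%:R :> R by rewrite ltr0n cardfs_gt0.
rewrite /bdry -[X in X + _](divff (lt0r_neq0 Fgt0)) -mulrDl.
rewrite ler_pM2r ?invr_gt0// -natrD ler_nat.
rewrite -(cardfsID F (mulfs K F)) leq_add2r.
by rewrite fsubset_leq_card// fsubsetIr.
Qed.

Lemma cvg_bdry (R : realType) (G : groupType) (F : nat -> {fset G})
    (K : {fset G}) :
  folner R F -> bdry R K (F n) @[n --> \oo] --> (0 : R).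
Proof.
move=> [F0 /(_ K) /= Fol]; apply: squeeze_cvgr Fol; last exact: cvg_cst.
near=> n; rewrite bdry_ge0 /= /bdry ler_pM2r ?invr_gt0 ?ltr0n ?cardfs_gt0//.
by rewrite ler_nat fsubset_leq_card// fsubsetUl.
Unshelve. all: by end_near. Qed.

Lemma rate_shearer (R : realType) (G : groupType) (C : finType)
    (Z : set (full_shift G C)) (F Q : {fset G}) :
  (forall g x, Z x -> Z (shift g x)) -> Q != fset0 -> F != fset0 ->
  rate R Z F <= rate R Z Q * (1 + bdry R (invfs Q) F).
Proof.
move=> sZ Q0 F0.
have Fgt0 : 0 < #|`F|%:R :> R by rewrite ltr0n cardfs_gt0.
have Qgt0 : 0 < #|`Q|%:R :> R by rewrite ltr0n cardfs_gt0.
apply: le_trans (_ : rate R Z Q * (#|`mulfs (invfs Q) F|%:R / #|`F|%:R) <= _).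
  rewrite /rate mulrA ler_pM2r ?invr_gt0// mulrAC ler_pdivlMr// mulrC.
  by rewrite [leRHS]mulrC -!lnnX ler_lnn// (npat_shearer R).
by rewrite ler_wpM2l ?rate_ge0// mulfs_ratio.
Qed.

(** An infimum is defined without convergence; [cvg_rate] identifies it with the limit and
    [entropyE] with the entropy. *)
Definition pent (R : realType) (G : groupType) (F : nat -> {fset G})
  (C : finType) (Z : set (full_shift G C)) : R :=
  inf (range (fun n => rate R Z (F n))).

(** If the rate at [F m] is within e/2 of the infimum, [rate_shearer] with Q = F m bounds the rate
    at [F n] by it, up to a boundary term that vanishes as n grows. *)
Lemma cvg_rate (R : realType) (G : groupType) (F : nat -> {fset G})
    (C : finType) (Z : set (full_shift G C)) :
  folner R F -> (forall g x, Z x -> Z (shift g x)) ->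
  rate R Z (F n) @[n --> \oo] --> pent R F Z.
Proof.
move=> Fol sZ; have F0 := Fol.1.
have hinf : has_inf (range (fun n => rate R Z (F n))).
  by split; [exists (rate R Z (F 0%N)), 0%N|exists 0 => _ [n _ <-]; apply: rate_ge0].
have lb n : pent R F Z <= rate R Z (F n).
  by apply: ge_inf; [exact: hinf.2|exists n].
apply/cvgrPdist_le => e e0.
have [_ [m _ <-] hm] := inf_adherent (divr_gt0 e0 (ltr0n R 2)) hinf.
have : (rate R Z (F m) * bdry R (invfs (F m)) (F n)) @[n --> \oo] -->
    (rate R Z (F m) * 0).
  by apply: cvgM; [exact: cvg_cst|exact: cvg_bdry].
rewrite mulr0 => /cvgrPdist_le /(_ (e / 2)) H.
near=> n.
have H' : rate R Z (F m) * bdry R (invfs (F m)) (F n) <= e / 2.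
  have : `|0 - rate R Z (F m) * bdry R (invfs (F m)) (F n)| <= e / 2.
    by near: n; apply: H; rewrite divr_gt0.
  by rewrite sub0r normrN ger0_norm// mulr_ge0 ?rate_ge0 ?bdry_ge0.
have := rate_shearer R sZ (F0 m) (F0 n); rewrite mulrDr mulr1 => ub.
rewrite distrC ger0_norm ?subr_ge0// lerBlDr.
apply: le_trans ub _; move: hm H'; rewrite -/(pent R F Z); lra.
Unshelve. all: by end_near. Qed.

(** The common passage to the limit: an estimate on each [F n] may lose a multiple of the boundary
    ratio. The sequence [v] stands for pattern rates and for cover counts alike. *)
Lemma pent_le_err (R : realType) (G : groupType) (F : nat -> {fset G})
    (C : finType) (Z : set (full_shift G C)) (v : nat -> R) (l c d : R)
    (K : {fset G}) :
  folner R F -> (forall g x, Z x -> Z (shift g x)) ->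
  v @ \oo --> l ->
  (forall n, v n <= rate R Z (F n) + c + d * bdry R K (F n)) ->
  l <= pent R F Z + c.
Proof.
move=> Fol sZ vl h.
have H : (rate R Z (F n) + c + d * bdry R K (F n)) @[n --> \oo] -->
    (pent R F Z + c + d * 0).
  apply: cvgD; last by apply: cvgM; [exact: cvg_cst|exact: cvg_bdry].
  by apply: cvgD; [exact: cvg_rate|exact: cvg_cst].
rewrite mulr0 addr0 in H.
by apply: ler_cvg_to vl H _; near=> n; apply: h.
Unshelve. all: by end_near. Qed.

(** * Finite windows and the topology of the full shift *)

Lemma agreeW (G : groupType) (C : Type) (K L : {fset G}) (x y : G -> C) :
  (K `<=` L)%fset -> agree L x y -> agree K x y.
Proof. by move=> /fsubsetP KL h k /KL; apply: h. Qed.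

Lemma agree_sym (G : groupType) (C : Type) (K : {fset G}) (x y : G -> C) :
  agree K x y -> agree K y x.
Proof. by move=> h k /h. Qed.

Lemma agree_trans (G : groupType) (C : Type) (K : {fset G}) (x y z : G -> C) :
  agree K x y -> agree K y z -> agree K x z.
Proof. by move=> h h' k kK; rewrite h// h'. Qed.

Lemma shift_shift (G : groupType) (A : finType) (g h : G) (x : full_shift G A) :
  shift g (shift h x) = shift (g * h)%g x.
Proof. by apply/funext => k; rewrite /shift mulgA. Qed.

Lemma shift1 (G : groupType) (A : finType) (x : full_shift G A) :
  shift 1%g x = x.
Proof. by apply/funext => k; rewrite /shift mulg1. Qed.

Lemma shiftK (G : groupType) (A : finType) (g : G) :
  cancel (@shift G A g) (shift g^-1%g).
Proof. by move=> x; rewrite shift_shift mulVg shift1. Qed.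

Lemma agree_shift (G : groupType) (A : finType) (K F : {fset G}) (g : G)
    (x y : full_shift G A) :
  g \in F -> agree (mulfs K F) x y -> agree K (shift g x) (shift g y).
Proof. by move=> gF h k kK; apply: h; apply: mem_mulfs. Qed.

Lemma cvg_full_shift (G : groupType) (A : finType)
    (F : set_system (full_shift G A)) (x : full_shift G A) :
  Filter F -> (forall g, F [set y | x g = y g]) -> F --> x.
Proof.
move=> FF h; apply/cvg_sup => g U [V] [[W] oW <-] Wx WU.
by apply: (filterS WU); apply: filterS (h g) => y /= <-.
Qed.

Lemma nbhs_agree (G : groupType) (A : finType) (x : full_shift G A)
    (K : {fset G}) :
  nbhs x [set y | agree K x y].
Proof.
have h g : nbhs x [set y : full_shift G A | x g = y g].
  have dx : nbhs (x g : discrete_topology A) [set x g].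
    exact: (@discrete_set1 (discrete_topology A) (x g)).
  have := @proj_continuous G (fun=> discrete_topology A) g x [set x g] dx.
  move=> H.
  apply: (@filterS _ (nbhs x) _ (fun y => y g = x g)).
    by move=> y yg; apply: esym yg.
  exact: H.
have -> : [set y | agree K x y] =
    \bigcap_(k in [set` K]) [set y : full_shift G A | x k = y k].
  by apply/seteqP; split=> y /= yK k; apply: yK.
by apply: filter_bigI => k _; apply: h.
Qed.

Lemma nbhs_full_shiftP (G : groupType) (A : finType) (x : full_shift G A)
    (U : set (full_shift G A)) :
  nbhs x U <-> exists K, [set y | agree K x y] `<=` U.
Proof.
split=> [Ux|[K KU]]; last exact: filterS KU (nbhs_agree _ _).
pose F := filter_from [set: {fset G}] (fun K => [set y | agree K x y]).
have FF : Filter F.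
  apply: filter_from_filter => [|K L _ _]; first by exists fset0.
  exists (K `|` L)%fset => // y xy; split; apply: agreeW xy.
    exact: fsubsetUl.
  exact: fsubsetUr.
have /(_ U Ux) [K _ KU] : F --> x; last by exists K.
apply: cvg_full_shift => g; exists [fset g]%fset => // y /=.
by apply; rewrite inE.
Qed.

Lemma full_shift_compact (G : groupType) (A : finType) :
  compact [set: full_shift G A].
Proof.
have -> : [set: full_shift G A] =
    [set f : full_shift G A | forall g, [set: discrete_topology A] (f g)].
  by apply/seteqP; split.
apply: (@tychonoff G (fun=> discrete_topology A) (fun=> setT)) => _.
by apply: finite_compact; apply: finite_finset.
Qed.

Lemma full_shift_hausdorff (G : groupType) (A : finType) :
  hausdorff_space (full_shift G A).
Proof.
exact: (@hausdorff_product G (fun=> discrete_topology A)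
  (fun=> @discrete_hausdorff _)).
Qed.

Lemma closed_full_shift_compact (G : groupType) (A : finType)
    (X : set (full_shift G A)) :
  closed X -> compact X.
Proof.
move=> cX; exact: (subclosed_compact cX (@full_shift_compact G A) (@subsetT _ _)).
Qed.

(** Compactness in near-covering form, along the filter of finite windows under inclusion. It yields
    both the window of a factor map and the Lebesgue number of a cover. *)
Lemma compact_uniform (G : groupType) (A : finType) (X : set (full_shift G A))
    (P : {fset G} -> full_shift G A -> Prop) :
  closed X ->
  (forall K L x, (K `<=` L)%fset -> P K x -> P L x) ->
  (forall x, X x -> exists K, forall y, X y -> agree K x y -> P K y) ->
  exists K, forall x, X x -> P K x.
Proof.
move=> /closed_full_shift_compact/compact_near_coveringP/near_covering_withinP.
move=> cX mP lP.
pose Fil := filter_from [set: {fset G}] (fun K => [set L | (K `<=` L)%fset]).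
have FF : Filter Fil.
  apply: filter_from_filter => [|K L _ _]; first by exists fset0.
  exists (K `|` L)%fset => // M /=; rewrite fsubUset => /andP[]; by split.
have [|K _ KX] := cX _ Fil P FF.
  move=> x Xx; have [K KP] := lP x Xx.
  exists ([set y | agree K x y], [set L | (K `<=` L)%fset]) => /=.
    by split; [exact: nbhs_agree|exists K].
  by move=> [y L] /= [xy KL] Xy; apply: (mP K) => //; apply: KP.
by exists K => x Xx; apply: KX => /=.
Qed.

Lemma within_continuous_localP (G : groupType) (A B : finType)
    (X : set (full_shift G A)) (f : full_shift G A -> full_shift G B) :
  {within X, continuous f} <->
  forall x, X x -> forall g, exists K, forall y, X y -> agree K x y ->
    f x g = f y g.
Proof.
split=> [/subspace_continuousP cf x Xx g|h].
  have := cf x Xx _ (nbhs_agree (f x) [fset g]%fset).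
  move=> /nbhs_full_shiftP [K KU]; exists K => y Xy xy.
  by apply: (KU y xy Xy); rewrite inE.
apply/subspace_continuousP => x Xx; apply: cvg_full_shift => g.
have [K KP] := h x Xx g; apply/nbhs_full_shiftP; exists K => y /= xy Xy.
exact: KP.
Qed.

(** The compactness half of the Curtis-Hedlund-Lyndon theorem; in [pent_factor] equivariance carries
    the window to the other sites. *)
Lemma factor_window (G : groupType) (A B : finType)
    (X : set (full_shift G A)) (f : full_shift G A -> full_shift G B) :
  closed X -> {within X, continuous f} ->
  exists K, forall x y, X x -> X y -> agree K x y -> f x 1%g = f y 1%g.
Proof.
move=> cX /within_continuous_localP lf.
have [|x Xx|K KP] := compact_uniform (P := fun K x => forall y, X y ->
    agree K x y -> f x 1%g = f y 1%g) cX; last by exists K => x y Xx; apply: KP.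
  by move=> K L x KL KP y Xy xy; apply: KP => //; apply: agreeW xy.
have [K KP] := lf x Xx 1%g; exists K => y Xy xy z Xz yz.
by rewrite -(KP y)// -(KP z)//; apply: agree_trans yz.
Qed.

Lemma subshift_image (G : groupType) (A B : finType)
    (X : set (full_shift G A)) (f : full_shift G A -> full_shift G B) :
  subshift X -> {within X, continuous f} ->
  (forall g x, X x -> f (shift g x) = shift g (f x)) ->
  subshift (f @` X).
Proof.
move=> [cX sX] cf ef; split.
  apply: compact_closed; first exact: full_shift_hausdorff.
  exact: continuous_compact cf (closed_full_shift_compact cX).
by move=> g _ [x Xx <-]; exists (shift g x); [exact: sX|exact: ef].
Qed.

(** Beyond the pattern on [F], only the symbols on KF \ F matter, and these form at most |A|^|KF \
    F| patterns. *)
Lemma nval_window (R : realType) (G : groupType) (A S : finType)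
    (X : set (full_shift G A)) (a : full_shift G A -> S) (K F : {fset G}) :
  (forall x y, X x -> X y -> agree (mulfs K F) x y -> a x = a y) ->
  lnn R (nval X a) / #|`F|%:R <= rate R X F + lnn R #|A| * bdry R K F.
Proof.
move=> det; rewrite /rate /bdry mulrA -mulrDl ler_wpM2r ?invr_ge0//.
rewrite [lnn R _ * _]mulrC -lnnX.
apply: le_trans (lnnM _ _ _); apply: ler_lnn.
set E := (mulfs K F `\` F)%fset.
apply: (@leq_trans (nval X (fun x => (pat F x, pat E x)))).
  apply: leq_nval_det => // x y Xx Xy [/pat_eqP xyF /pat_eqP xyE].
  apply: det => // k kKF; have [kF|kF] := boolP (k \in F); first exact: xyF.
  by apply: xyE; rewrite inE kF.
apply: leq_nval_pair => s; apply: leq_trans (max_card _) _.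
by rewrite card_ffun -cardfE.
Qed.

Lemma pent_factor (R : realType) (G : groupType) (F : nat -> {fset G})
    (A B : finType) (X : set (full_shift G A)) (Y : set (full_shift G B))
    (f : full_shift G A -> full_shift G B) :
  folner R F -> subshift X -> subshift Y -> factor_map X Y f ->
  pent R F Y <= pent R F X.
Proof.
move=> Fol [cX sX] [_ sY] [cf fX ef].
have [K KP] := factor_window cX cf.
rewrite -[leRHS]addr0.
apply: (pent_le_err (d := lnn R #|A|) (K := K) Fol sX (cvg_rate Fol sY)) => n.
rewrite addr0; apply: le_trans (nval_window R (X := X) (a := pat (F n) \o f) _).
  rewrite ler_wpM2r ?invr_ge0// ler_lnn//.
  apply: (leq_nval (r := fun y x => y = f x)).
    by move=> y; rewrite -fX => -[x Xx <-]; exists x.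
  by move=> y y' x x' _ _ _ _ -> ->.
move=> x y Xx Xy xy; apply/pat_eqP => g gF.
have e z : f z g = shift g (f z) 1%g by rewrite /shift mul1g.
by rewrite !e -!ef//; apply: KP; [exact: sX|exact: sX|exact: agree_shift xy].
Qed.

(** * Topological entropy as a growth rate of patterns *)

Lemma card_nval (T : Type) (S : finType) (X : set T) (a : T -> S) :
  (a @` X #= `I_(nval X a))%card.
Proof.
pose P : pred S := [pred s | `[< exists2 x, X x & a x = s >]].
have -> : a @` X = [set` [fset s in P]%fset].
  apply/seteqP; split=> s /=.
    by move=> Xs; rewrite !inE.
  by rewrite !inE.
by apply/card_eq_fsetP; rewrite (card_finset P).
Qed.

Lemma min_subcoverP (T : Type) (X : set T) (U : set (set T)) (k : nat) :
  subcover_size X U k ->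
  subcover_size X U (min_subcover X U) /\ (min_subcover X U <= k)%N.
Proof.
move=> Uk; rewrite /min_subcover; set M := [set _ | _].
have ex : exists k, `[< subcover_size X U k >] by exists k; apply/asboolP.
have [|Um hm] := @xgetPex nat 0%N M; last by split=> //; apply: hm.
exists (ex_minn ex); case: ex_minnP => m /asboolW Um hm; split=> // l Ul.
by apply: hm; apply/asboolP.
Qed.

Lemma min_subcover_leq (T : Type) (S : finType) (X : set T) (U : set (set T))
    (a : T -> S) :
  (forall x, X x -> exists2 v, U v & forall y, X y -> a y = a x -> v y) ->
  subcover_size X U (min_subcover X U) /\ (min_subcover X U <= nval X a)%N.
Proof.
move=> h.
have /choice [w hw] (s : S) : exists v, (exists2 x, X x & a x = s) ->
    U v /\ forall y, X y -> a y = s -> v y.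
  have [[x Xx <-]|nex] := pselect (exists2 x, X x & a x = s).
    by have [v Uv hv] := h x Xx; exists v => _; split.
  by exists set0.
have wle : (w @` (a @` X) #<= `I_(nval X a))%card.
  apply: card_le_trans (card_image_le _ _) _.
  by have /card_eqPle[] := card_nval X a.
(* Several values may share a chosen member, so the size [k] of the subcover may be below
   [nval X a]. *)
have /finite_setP [k wk] : finite_set (w @` (a @` X)).
  exact: card_le_finite wle (finite_II _).
have Uk : subcover_size X U k.
  exists (w @` (a @` X)); split=> //.
    by move=> _ [_ [x Xx <-] <-]; apply: (hw (a x) _).1; exists x.
  move=> x Xx; exists (w (a x)); first by exists (a x) => //; exists x.
  by apply: (hw (a x) _).2 => //; exists x.
have [Um mk] := min_subcoverP Uk; split=> //; apply: leq_trans mk _.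
rewrite -card_le_II; apply: card_le_trans wle.
by have /card_eqPle[] := wk.
Qed.

(** A member of the cover carries at most one value of [a], so a subcover maps onto the set of
    values, with [None] for the members that miss [X]. *)
Lemma min_subcover_geq (T : Type) (S : finType) (X : set T) (U : set (set T))
    (a : T -> S) (k : nat) :
  subcover_size X U k ->
  (forall v x y, U v -> X x -> X y -> v x -> v y -> a x = a y) ->
  (nval X a <= k)%N.
Proof.
move=> [V [VU XV Vk]] h.
have /choice [u hu] (v : set T) : exists s : option S,
    forall x, X x -> U v -> v x -> s = Some (a x).
  have [[x [Xx Uv vx]]|nex] := pselect (exists x, [/\ X x, U v & v x]).
    by exists (Some (a x)) => y Xy _ vy; congr Some; apply: (h v).
  by exists None => x Xx Uv vx; case: nex; exists x.
rewrite -card_le_II.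
have /card_eqPle [_ H1] := card_nval X a; apply: card_le_trans H1 _.
have /card_eqPle [H2 _] := Vk; apply: card_le_trans H2.
apply: card_le_trans (card_image_le u V).
rewrite -card_ge_some.
apply: subset_card_le => _ [_ [x Xx <-] <-].
have [v Vv vx] := XV x Xx; exists v => //; apply: hu => //; exact: VU.
Qed.

Lemma pent_ge0 (R : realType) (G : groupType) (F : nat -> {fset G})
  (C : finType) (Z : set (full_shift G C)) : 0 <= pent R F Z.
Proof.
apply: lb_le_inf; first by exists (rate R Z (F 0%N)), 0%N.
by move=> _ [n _ <-]; apply: rate_ge0.
Qed.

(** Upper bound: patterns on K F_n refine the join of a cover for which [K] acts as a Lebesgue
    number. Lower bound: for the partition by the symbol at the identity, the join over [F n]
    separates exactly the patterns on [F n]. *)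
Lemma entropyE (R : realType) (G : groupType) (F : nat -> {fset G})
    (A : finType) (X : set (full_shift G A)) :
  folner R F -> subshift X -> entropy R F X = (pent R F X)%:E.
Proof.
move=> Fol [cX sX].
pose J (U : set (set (full_shift G A))) n :=
  cover_join (F n) (fun g => shift_cover g^-1%g U).
pose N U n := min_subcover X (J U n).
apply/eqP; rewrite eq_le; apply/andP; split.
  apply: ge_ereal_sup => _ [U [finU openU covU] <-]; rewrite lee_fin.
  rewrite -/(N U _).
  (* For a general cover the existence of the limit would need the Ornstein-Weiss
     lemma; without convergence [lim] is the junk value 0, which does no harm. *)
  have [cvgN|/dvgP ->] :=
    pselect (cvg (lnn R (N U n) / #|`F n|%:R @[n --> \oo])); last exact: pent_ge0.
  (* The Lebesgue number: within [X], the cylinder over [K] around each point lies in one member of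
     [U]. *)
  have [| |K KP] := compact_uniform (P := fun K x => exists2 u, U u &
      forall y, X y -> agree K x y -> u y) cX.
  - move=> K L x KL [u Uu hu]; exists u => // y Xy xy; apply: hu => //.
    exact: agreeW xy.
  - move=> x Xx; have : (\bigcup_(u in U) u) x by rewrite covU.
    move=> [u Uu ux]; have [W oW uW] := openU u Uu.
    have /nbhs_full_shiftP [K KW] : nbhs x W.
      by apply: open_nbhs_nbhs; split=> //; move: ux; rewrite uW => -[].
    exists K => y Xy xy; exists u => // z Xz yz; rewrite uW; split=> //.
    by apply: KW; apply: agree_trans yz.
  rewrite -[leRHS]addr0.
  apply: (pent_le_err (d := lnn R #|A|) (K := K) Fol sX cvgN) => n.
  rewrite addr0; apply: le_trans
    (nval_window R (X := X) (a := pat (mulfs K (F n))) (K := K) (F := F n) _);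
    last by move=> x y _ _ /pat_eqP.
  rewrite ler_wpM2r ?invr_ge0// ler_lnn//.
  apply: (min_subcover_leq _).2 => x Xx.
  have /choice [u hu] (g : G) : exists u, U u /\
      forall y, X y -> agree K (shift g x) y -> u y.
    by have [u Uu hu] := KP _ (sX g x Xx); exists u.
  exists (\bigcap_(g in [set` F n]) (shift g^-1%g @` (u g))).
    exists (fun g => shift g^-1%g @` (u g)) => // g gF.
    by exists (u g) => //; apply: (hu g).1.
  move=> y Xy /esym/pat_eqP xy g gF; exists (shift g y); last exact: shiftK.
  by apply: (hu g).2; [exact: sX|exact: agree_shift xy].
pose U := [set [set x | X x /\ x 1%g = a] | a in [set: A]].
have NU n : N U n = npat X (F n).
  have [] := @min_subcover_leq _ _ X (J U n) (pat (F n)).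
    move=> x Xx.
    exists (\bigcap_(g in [set` F n])
        (shift g^-1%g @` [set y | X y /\ y 1%g = x g])).
      exists (fun g => shift g^-1%g @` [set y | X y /\ y 1%g = x g]) => // g gF.
      by exists [set y | X y /\ y 1%g = x g] => //; exists (x g).
    move=> y Xy /pat_eqP yx g gF; exists (shift g y); last exact: shiftK.
    by split; [exact: sX|rewrite /shift mul1g yx].
  move=> Nsize Nle; apply/eqP; rewrite eqn_leq Nle/=.
  apply: min_subcover_geq Nsize _ => _ x y [u hu <-] Xx Xy xu yu.
  apply/pat_eqP => g gF.
  have [_ [a _ <-] ug] := hu g gF.
  have hz z : shift g^-1%g @` [set y | X y /\ y 1%g = a] = u g ->
      (\bigcap_(g in [set` F n]) u g) z -> z g = a.
    move=> e /(_ g gF); rewrite -e => -[t [Xt ta] <-].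
    by rewrite /shift mulgV.
  by rewrite !hz.
apply: ereal_sup_ubound; exists U.
  split.
  - by apply: finite_image; apply: finite_finset.
  - move=> _ [a _ <-]; exists [set x | x 1%g = a]; last by [].
    rewrite openE => x xa; apply/nbhs_full_shiftP; exists [fset 1%g]%fset.
    by move=> y /= xy; rewrite -xa xy// inE.
  - apply/seteqP; split=> [x [_ [a _ <-] []]//|x Xx].
    by exists [set y | X y /\ y 1%g = x 1%g] => //; exists (x 1%g).
congr EFin; rewrite -/(N U _).
have -> : (fun n => ln (N U n)%:R / #|`F n|%:R) = (fun n => rate R X (F n)).
  by apply/funext => n; rewrite NU.
by apply/cvg_lim => //; exact: cvg_rate.
Qed.

(** * Hiding symbols on a clopen set *)

Definition windowed (G : groupType) (A : finType) (W : {fset G})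
    (D : set (full_shift G A)) :=
  forall x y, agree W x y -> D x -> D y.

(** The image of [X] is the factor Z_D of the overview; the first component provides the map onto
    [Y]. *)
Definition hide (G : groupType) (A B : finType)
    (pi : full_shift G A -> full_shift G B) (D : set (full_shift G A))
    (x : full_shift G A) : full_shift G (B * option A)%type :=
  fun g => (pi x g, if `[< D (shift g x) >] then None else Some (x g)).

Lemma npat_image (G : groupType) (A C : finType) (X : set (full_shift G A))
    (f : full_shift G A -> full_shift G C) (F : {fset G}) :
  npat (f @` X) F = nval X (fun x => pat F (f x)).
Proof.
apply/eqP; rewrite eqn_leq; apply/andP; split.
  apply: (leq_nval (r := fun (y : full_shift G C) x => y = f x)).
    by move=> _ [x Xx <-]; exists x.
  by move=> y y' x x' _ _ _ _ -> ->.
apply: (leq_nval (r := fun x (y : full_shift G C) => y = f x)).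
  by move=> x Xx; exists (f x) => //; exists x.
by move=> x x' y y' _ _ _ _ -> ->.
Qed.

Lemma pent_le (R : realType) (G : groupType) (F : nat -> {fset G})
    (C C' : finType) (Z : set (full_shift G C)) (Z' : set (full_shift G C')) :
  folner R F -> subshift Z -> subshift Z' ->
  (forall E : {fset G}, (npat Z E <= npat Z' E)%N) ->
  pent R F Z <= pent R F Z'.
Proof.
move=> Fol [_ sZ] [_ sZ'] h; rewrite -[leRHS]addr0.
apply: (pent_le_err (d := 0) (K := fset0) Fol sZ' (cvg_rate Fol sZ)) => n.
by rewrite mul0r !addr0 ler_wpM2r ?invr_ge0// ler_lnn.
Qed.

Section Hide.
Variables (R : realType) (G : groupType) (F : nat -> {fset G}).
Hypothesis Fol : folner R F.
Variables (A B : finType).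
Variables (X : set (full_shift G A)) (Y : set (full_shift G B)).
Hypotheses (subX : subshift X) (subY : subshift Y).
Variable pi : full_shift G A -> full_shift G B.
Hypothesis factor_pi : factor_map X Y pi.

Lemma hide_shift D g x : X x -> hide pi D (shift g x) = shift g (hide pi D x).
Proof.
have [_ _ epi] := factor_pi => Xx; apply/funext => h.
by rewrite /hide epi// shift_shift.
Qed.

Lemma hide_continuous W D : windowed W D -> {within X, continuous (hide pi D)}.
Proof.
have [/within_continuous_localP cpi _ _] := factor_pi => WD.
apply/within_continuous_localP => x Xx g; have [K KP] := cpi x Xx g.
exists (K `|` (mulfs W [fset g] `|` [fset g]))%fset => y Xy xy.
have xyW : agree W (shift g x) (shift g y).
  apply: (@agree_shift _ _ _ [fset g]%fset); first by rewrite inE.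
  by apply: agreeW xy; rewrite fsubsetU// fsubsetUl orbT.
rewrite /hide (KP y Xy); last by apply: agreeW xy; apply: fsubsetUl.
have -> : x g = y g by apply: xy; rewrite !inE eqxx !orbT.
suff -> : D (shift g x) = D (shift g y) by [].
by apply/propext; split; apply: WD => //; apply: agree_sym.
Qed.

Lemma subshift_hide W D : windowed W D -> subshift (hide pi D @` X).
Proof.
move=> WD; apply: subshift_image => //; first exact: hide_continuous WD.
by move=> g x; apply: hide_shift.
Qed.

Lemma hide_intermediate W D : windowed W D ->
  intermediate_entropies F X Y pi (pent R F (hide pi D @` X)).
Proof.
move=> WD; have sZ := subshift_hide WD.
pose psi (z : full_shift G (B * option A)%type) : full_shift G B :=
  fun g => (z g).1.
exists (B * option A)%type, (hide pi D @` X), (hide pi D), psi; split => //.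
- exact: entropyE.
- by split=> //; [exact: hide_continuous WD|move=> g x; apply: hide_shift].
- have [_ piX _] := factor_pi; split=> //.
    apply/within_continuous_localP => z Zz g; exists [fset g]%fset => y _.
    by move=> /(_ g); rewrite /psi inE eqxx => ->.
  rewrite -piX; apply/seteqP; split=> [_ [_ [x Xx <-] <-]|_ [x Xx <-]].
    by exists x.
  by exists (hide pi D x) => //; exists x.
Qed.

Lemma pent_hide0 : pent R F X <= pent R F (hide pi set0 @` X).
Proof.
have W0 : windowed fset0 (set0 : set (full_shift G A)) by [].
apply: pent_le => // [|E]; first exact: subshift_hide W0.
rewrite npat_image; apply: leq_nval_det => // x y Xx Xy.
have h0 x' g : (hide pi set0 x' g).2 = Some (x' g) by rewrite /hide/= asboolF.
move=> /pat_eqP h; apply/pat_eqP => g gE; apply: Some_inj.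
by rewrite -!h0 h.
Qed.

Lemma pent_hideT : pent R F (hide pi setT @` X) <= pent R F Y.
Proof.
have WT : windowed fset0 (setT : set (full_shift G A)) by [].
apply: pent_le => // [|E]; first exact: subshift_hide WT.
rewrite npat_image.
apply: (leq_nval (r := fun x (y : full_shift G B) => y = pi x)).
  by have [_ <- _] := factor_pi => x Xx; exists (pi x) => //; exists x.
have hT x' g : hide pi setT x' g = (pi x' g, None) by rewrite /hide/= asboolT.
move=> x x' _ _ _ _ _ _ -> -> /pat_eqP h; apply/pat_eqP => g gE.
by rewrite !hT h.
Qed.

(** What has to be added to [hide pi D'] in order to recover [hide pi D]. *)
Definition new (D D' : set (full_shift G A)) (x : full_shift G A) (g : G) :
    option A :=
  if `[< D' (shift g x) /\ ~ D (shift g x) >] then Some (x g) else None.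

Lemma hide_new (D D' : set (full_shift G A)) x g : D `<=` D' ->
  hide pi D x g = ((hide pi D' x g).1,
    if new D D' x g is Some a then Some a else (hide pi D' x g).2).
Proof.
move=> DD'; rewrite /hide /new /=; congr pair.
case: (asboolP (_ /\ _)) => [[D'g nDg]|nDD'g]; first by rewrite asboolF.
have [Dg|nDg] := pselect (D (shift g x)).
  by rewrite !asboolT//; apply: DD'.
by rewrite !asboolF// => D'g; apply: nDD'g.
Qed.

(** Shearer's inequality for [new] on the fibre over each pattern [z] of the coarser factor: at most
    [m] values on each translate of [Q] give a relative growth rate of at most log m / |Q|. *)
Lemma pent_hide_step (W W' Q : {fset G}) (D D' : set (full_shift G A)) (m : nat) :
  windowed W D -> windowed W' D' -> D `<=` D' -> Q != fset0 ->
  (forall (E : {fset G}) (z : {ffun E -> B * option A}) (g : G),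
     (nval (X `&` [set x | pat E (hide pi D' x) = z])
       (fun x => mask E [pred w | (w * g^-1)%g \in Q] (new D D' x)) <= m)%N) ->
  pent R F (hide pi D @` X) <=
    pent R F (hide pi D' @` X) + lnn R m / #|`Q|%:R.
Proof.
move=> WD WD' DD' Q0 hm.
have [_ sZ] := subshift_hide WD; have [_ sZ'] := subshift_hide WD'.
set c := lnn R m / _.
(* The boundary error has coefficient [c] because |Q^-1 E| is at most |E| times one plus the
   boundary ratio. *)
apply: (pent_le_err (d := c) (K := invfs Q) Fol sZ' (cvg_rate Fol sZ)) => n.
set E := F n; have E0 : E != fset0 by apply: Fol.1.
have Egt0 : 0 < #|`E|%:R :> R by rewrite ltr0n cardfs_gt0.
have Qgt0 : 0 < #|`Q|%:R :> R by rewrite ltr0n cardfs_gt0.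
have c0 : 0 <= c by rewrite divr_ge0// lnn_ge0.
rewrite -addrA -{1}[c]mulr1 -mulrDr.
apply: (@le_trans _ _ (rate R (hide pi D' @` X) E +
    c * (#|`mulfs (invfs Q) E|%:R / #|`E|%:R))); last first.
  by rewrite lerD2l ler_wpM2l// mulfs_ratio.
rewrite /rate mulrA -mulrDl ler_pM2r ?invr_gt0//.
pose nz z := nval (X `&` [set x | pat E (hide pi D' x) = z])
  (fun x => pat E (new D D' x)).
pose M := (\max_z nz z)%N.
have hM : (M ^ #|`Q| <= m ^ #|`mulfs (invfs Q) E|)%N.
  apply: (big_ind (fun k => k ^ #|`Q| <= m ^ #|`mulfs (invfs Q) E|)%N).
  - by rewrite exp0n ?cardfs_gt0.
  - by move=> k l hk hl; rewrite /maxn; case: ifP.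
  - by move=> z _; apply: (shearer_group R) => // g; apply: hm.
have hMc : lnn R M <= c * #|`mulfs (invfs Q) E|%:R.
  rewrite /c mulrAC ler_pdivlMr// mulrC [leRHS]mulrC -!lnnX; exact: ler_lnn.
apply: le_trans (_ : lnn R (npat (hide pi D' @` X) E * M) <= _); last first.
  by apply: le_trans (lnnM _ _ _) _; rewrite lerD2l.
apply: ler_lnn; rewrite !npat_image.
apply: leq_trans (leq_nval_pair (b := fun x => pat E (new D D' x)) _); last first.
  by move=> z; apply: (@leq_bigmax _ nz).
apply: leq_nval_det => // x y Xx Xy [/pat_eqP h' /pat_eqP hn].
apply/pat_eqP => g gE; by rewrite !(hide_new _ _ DD') h' ?hn.
Qed.
End Hide.

(** * The two kinds of steps *)

(** Equivalently, [shift s x] agrees with [x] on [L] for each [s] in [S]. *)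
Definition periodic (G : groupType) (A : finType) (S L : {fset G}) :
    set (full_shift G A) :=
  [set x | forall s h, s \in S -> h \in L -> x (h * s)%g = x h].

Lemma windowed_periodic (G : groupType) (A : finType) (S L : {fset G}) :
  windowed (L `|` mulfs L S)%fset (@periodic G A S L).
Proof.
move=> x y xy px s h sS hL; rewrite -!xy ?px// !inE ?hL//.
by rewrite mem_mulfs ?orbT.
Qed.

Lemma windowedU (G : groupType) (A : finType) (V W : {fset G})
    (D E : set (full_shift G A)) :
  windowed V D -> windowed W E -> windowed (V `|` W)%fset (D `|` E).
Proof.
move=> VD WE x y xy [Dx|Ex]; [left; apply: VD Dx|right; apply: WE Ex].
  by apply: agreeW xy; apply: fsubsetUl.
by apply: agreeW xy; apply: fsubsetUr.
Qed.

Lemma periodicW (G : groupType) (A : finType) (S L L' : {fset G}) :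
  (L `<=` L')%fset -> @periodic G A S L' `<=` @periodic G A S L.
Proof. by move=> /fsubsetP LL x px s h sS hL; apply: px => //; apply: LL. Qed.

(** Let y = shift (s g) x. The symbols to compare at [h] are y(h) and y(h t s^-1). Both equal y(h
    t), by periodicity under [t] at [h] and under [s] at h t s^-1; hence the two conditions on
    [L]. *)
Lemma periodic_agree (G : groupType) (A : finType) (S L W : {fset G})
    (x : full_shift G A) (s t g : G) :
  (W `<=` L)%fset -> (mulfs W (mulfs S (invfs S)) `<=` L)%fset ->
  s \in S -> t \in S -> periodic S L (shift (s * g)%g x) ->
  agree W (shift (s * g)%g x) (shift (t * g)%g x).
Proof.
move=> /fsubsetP WL /fsubsetP WSL sS tS px h hW.
have hst : (h * (t * s^-1))%g \in L.
  by apply: WSL; rewrite !mem_mulfs// mem_invfs.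
transitivity (shift (s * g)%g x (h * (t * s^-1))%g).
  rewrite -(px s _ sS hst) !mulgA mulgVK px//; exact: WL.
by rewrite /shift !mulgA mulgVK.
Qed.

Section Steps.
Variables (R : realType) (G : groupType) (F : nat -> {fset G}).
Hypothesis Fol : folner R F.
Variables (A B : finType).
Variables (X : set (full_shift G A)) (Y : set (full_shift G B)).
Hypotheses (subX : subshift X) (subY : subshift Y).
Variable pi : full_shift G A -> full_shift G B.
Hypothesis factor_pi : factor_map X Y pi.

(** If one site of a translate of [S] is newly hidden, all sites of the translate show the same
    [V]-window. So they carry the same symbol and none of them is in [D]; given [z], one element of
    [option A] determines the new symbols. *)
Lemma pent_hide_periodic (W S : {fset G}) (D : set (full_shift G A)) :
  windowed W D -> S != fset0 ->
  exists L, pent R F (hide pi D @` X) <=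
    pent R F (hide pi (D `|` periodic S L) @` X) + lnn R #|A|.+1 / #|`S|%:R.
Proof.
(* [W] transports membership in [D], and the identity transports the symbol. *)
move=> WD S0; set V := (W `|` [fset 1%g])%fset.
exists (V `|` mulfs V (mulfs S (invfs S)))%fset; set L := (V `|` _)%fset.
have WD' := windowedU WD (@windowed_periodic G A S L).
apply: (pent_hide_step Fol subX factor_pi WD WD' (@subsetUl _ _ _)) => //.
move=> E z g; set D' := D `|` _; rewrite -card_option.
(* [z] shows which sites are hidden; [u] is their common symbol, or [None] if no site is newly
   hidden. *)
pose f (u : option A) : {ffun E -> option (option A)} := [ffun i : E =>
  if (val i * g^-1)%g \in S then
    Some (if (z i).2 is None then u else None) else None].
apply: (nval_leq_card (f := f)) => x [Xx /ffunP xz].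
have zE (i : E) : (z i).2 =
    if `[< D' (shift (val i) x) >] then None else Some (x (val i)).
  by rewrite -xz ffunE.
have [[i [iS [D'i nDi]]]|none] := pselect (exists i : E,
    (val i * g^-1)%g \in S /\ D' (shift (val i) x) /\ ~ D (shift (val i) x)).
  exists (Some (x (val i))); apply/ffunP => j; rewrite !ffunE /=.
  case: ifP => // jS; congr Some; rewrite zE /new.
  have [D'j|nD'j] := pselect (D' (shift (val j) x)); last first.
    by rewrite asboolF ?asboolF// => -[].
  have pi' : periodic S L (shift (val i) x) by case: D'i.
  have : agree V (shift (val i) x) (shift (val j) x).
    have := @periodic_agree G A S L V x _ _ g _ _ iS jS.
    by rewrite !mulgVK; apply; rewrite ?fsubsetUl ?fsubsetUr.
  move=> ijV; have -> : x (val i) = x (val j).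
    have := ijV 1%g; rewrite /shift !mul1g; apply.
    by rewrite !inE eqxx orbT.
  rewrite !asboolT//; split=> // Dj; apply: nDi; apply: WD Dj.
  by apply: agree_sym; apply: agreeW ijV; apply: fsubsetUl.
exists None; apply/ffunP => j; rewrite !ffunE /=.
case: ifP => // jS; congr Some; rewrite /new asboolF; first by case: (z j).2.
by move=> Dj; apply: none; exists j.
Qed.

(** A set of at most [M] elements is coded by [M] slots, some possibly empty, so (|T| + 1)^M codes
    suffice. *)
Lemma seq_ffun (T : finType) (s : seq T) (M : nat) : (size s <= M)%N ->
  exists v : {ffun 'I_M -> option T}, forall t,
    (t \in s) = [exists m, v m == Some t].
Proof.
move=> sM; exists [ffun m : 'I_M => nth None (map Some s) m] => t.
apply/idP/existsP => [ts|[m]].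
  have im : (index t s < M)%N by apply: leq_trans sM; rewrite index_mem.
  exists (Ordinal im); rewrite ffunE /= (nth_map t) ?index_mem//.
  by rewrite nth_index.
rewrite ffunE; have [ms|sm] := ltnP m (size s).
  by rewrite (nth_map t)// => /eqP[<-]; apply: mem_nth.
by rewrite nth_default// size_map.
Qed.

(** Every newly hidden site shows [p] through [L], hence carries the symbol [p 1], and only the
    positions need to be coded. More than [M] of them in a translate of [K] would make the point
    periodic as seen from one of them, so that this site was already in [D]. *)
Lemma pent_hide_cylinder (W K L : {fset G}) (D : set (full_shift G A))
    (p : full_shift G A) (M : nat) :
  windowed W D -> K != fset0 -> (0 < M)%N -> 1%g \in L ->
  (forall S : {fset G}, (S `<=` mulfs K (invfs K))%fset -> #|`S| = M ->
    periodic S L `<=` D) ->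
  pent R F (hide pi D @` X) <=
    pent R F (hide pi (D `|` [set x | agree L p x]) @` X) +
    lnn R (#|`K|.+1 ^ M) / #|`K|%:R.
Proof.
move=> WD K0 M0 L1 perD.
have WC : windowed L [set x : full_shift G A | agree L p x].
  by move=> x y xy px; apply: agree_trans xy.
have WD' := windowedU WD WC.
apply: (pent_hide_step Fol subX factor_pi WD WD' (@subsetUl _ _ _)) => //.
move=> E z g; set D' := D `|` _.
have -> : (#|`K|.+1 ^ M)%N = #|{ffun 'I_M -> option K}|.
  by rewrite card_ffun card_option card_ord -cardfE.
pose f (v : {ffun 'I_M -> option K}) : {ffun E -> option (option A)} :=
  [ffun i : E => if insub (val i * g^-1)%g is Some k then
    Some (if [exists m, v m == Some k] then Some (p 1%g) else None) else None].
apply: (nval_leq_card (f := f)) => x [Xx _].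
pose isnew h := D' (shift h x) /\ ~ D (shift h x).
pose s := enum [pred k : K | `[< isnew (val k * g)%g >]].
have sP k : k \in s -> isnew (val k * g)%g.
  by rewrite mem_enum inE.
have [sM|Ms] := leqP (size s) M; last first.
  have [k0 k0s] : exists k0, k0 \in take M s.
    case: (take M s) (size_takel (ltnW Ms)) => [/= e|k0 t _].
      by rewrite -e in M0.
    by exists k0; rewrite inE eqxx.
  (* From the site k0 g, the elements of [S] lead to the chosen sites, which all show [p]; so the
     point shifted there is [S]-periodic through [L]. *)
  pose S : {fset G} := [fset (val k * (val k0)^-1)%g | k in take M s]%fset.
  have SM : #|`S| = M.
    rewrite card_imfset /=; last by move=> k l /mulIg/val_inj.
    rewrite undup_id ?size_takel ?(ltnW Ms)//.
    by rewrite take_uniq ?enum_uniq.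
  have [_ nD] := sP _ (mem_take k0s); case: nD; apply: (perD S) => //.
    apply/fsubsetP => _ /imfsetP[k /= _ ->].
    by apply: mem_mulfs; rewrite ?mem_invfs// fsvalP.
  move=> _ h /imfsetP[k /= ks ->] hL.
  have hx l : l \in take M s -> x (h * (val l * g))%g = p h.
    by move=> /mem_take/sP [[Dl|C] nDl]; [case: (nDl Dl)|rewrite (C h hL)].
  by rewrite /shift -!mulgA mulKg !hx.
have [v vP] := seq_ffun sM; exists v; apply/ffunP => i; rewrite !ffunE /=.
case: insubP => [k -> kE|/negbTE -> //]; congr Some.
rewrite -vP mem_enum inE kE mulgVK /new; case: asboolP => // -[[Di|C] nDi].
  by case: (nDi Di).
by rewrite (C 1%g L1) /shift mul1g.
Qed.
End Steps.

(** * Density *)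

Lemma lnn_div_lt (R : realType) (c e : R) : 0 <= c -> 0 < e ->
  exists n, forall k, (n <= k)%N -> c * lnn R k.+1 / k%:R < e.
Proof.
move=> c0 e0; exists (Num.bound ((4 * c / e) ^+ 2)).+1 => k nk.
have k0 : (0 < k)%N by apply: leq_trans nk.
pose s : R := Num.sqrt k.+1%:R.
have s2 : s ^+ 2 = k.+1%:R by rewrite sqr_sqrtr.
have s0 : 0 < s by rewrite sqrtr_gt0.
have k1 : 1 <= k%:R :> R by rewrite ler1n.
have lnk : lnn R k.+1 <= 2 * s.
  rewrite /lnn -s2 lnXn// -[leLHS]mulr_natl ler_wpM2l// ltW// ln_sublinear//.
have hb : 4 * c / e < s.
  rewrite -(ltr_pXn2r (n := 2))// ?nnegrE ?divr_ge0 ?mulr_ge0 ?(ltW e0) ?(ltW s0)//.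
  rewrite s2; apply: (lt_trans (archi_boundP _)).
    by rewrite exprn_ge0 ?divr_ge0 ?mulr_ge0 ?(ltW e0).
  by rewrite ltr_nat ltnS ltnW.
rewrite ltr_pdivrMr ?ltr0n//; apply: le_lt_trans (_ : c * (2 * s) < _).
  by rewrite ler_wpM2l.
have : 4 * c < s * e by rewrite -ltr_pdivrMr.
rewrite -natr1 in s2; rewrite expr2 in s2; nra.
Qed.

(** A discrete intermediate value argument: if no value lies within [e] of [r], then steps costing
    less than [e] never leave the values of at least r + e, although hiding everything brings the
    value down to at most [r]. *)
Lemma subset_closure_hide (R : realType) (G : groupType)
    (infG : infinite_set [set: G])
    (F : nat -> {fset G}) (Fol : folner R F) (A B : finType)
    (X : set (full_shift G A)) (Y : set (full_shift G B))
    (subX : subshift X) (subY : subshift Y)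
    (pi : full_shift G A -> full_shift G B) (factor_pi : factor_map X Y pi)
    (r e : R) :
  0 < e -> pent R F Y <= r <= pent R F X ->
  exists2 D, exists W, windowed W D & `|r - pent R F (hide pi D @` X)| < e.
Proof.
move=> e0 /andP[Yr rX]; apply: contrapT => none.
pose good D := (exists W, windowed W D) /\ r + e <= pent R F (hide pi D @` X).
have gap D : (exists W, windowed W D) -> r - e < pent R F (hide pi D @` X) ->
    good D.
  move=> WD hD; split=> //; rewrite leNgt; apply/negP => hD'; apply: none.
  by exists D => //; rewrite ltr_norml; apply/andP; split; lra.
have step D D' c : good D -> (exists W, windowed W D') -> c < e ->
    pent R F (hide pi D @` X) <= pent R F (hide pi D' @` X) + c -> good D'.
  by move=> [_ gD] WD' ce h; apply: gap => //; lra.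
have good0 : good set0.
  apply: gap; first by exists fset0.
  have := pent_hide0 Fol subX factor_pi; lra.
(* [M] depends on [A] and [e] only; [K] is then chosen large relative to [M], which is possible as
   [G] is infinite. *)
pose M := (Num.bound (lnn R #|A|.+1 / e)).+1.
have Me : lnn R #|A|.+1 / M%:R < e.
  rewrite ltr_pdivrMr ?ltr0n// mulrC -ltr_pdivrMr//.
  apply: lt_trans (archi_boundP _) _; first by rewrite divr_ge0 ?lnn_ge0 ?ltW.
  by rewrite ltr_nat.
have [m hm] := lnn_div_lt (ler0n R M) e0.
have [K _ mK] := infinite_set_fset m.+1 infG.
have K0 : K != fset0 by rewrite -cardfs_gt0; apply: leq_trans mK.
have Ke : lnn R (#|`K|.+1 ^ M) / #|`K|%:R < e by rewrite lnnX; apply/hm/ltnW.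
(* The sets [S] are treated in turn. Enlarging [L] only shrinks the periodic sets, so the inclusions
   already obtained persist. *)
have [D1 [L [gD1 perD1]]] : exists D L, good D /\
    forall S : {fset G}, (S `<=` mulfs K (invfs K))%fset -> #|`S| = M ->
      periodic S L `<=` D.
  suff [D [L [gD perD]]] : exists D L, good D /\
      forall S, S \in enum_fset (fpowerset (mulfs K (invfs K))) -> #|`S| = M ->
        periodic S L `<=` D.
    by exists D, L; split=> // S; rewrite -fpowersetE => SK; apply: perD.
  elim: (enum_fset (fpowerset _)) => [|S Ss [D [L [gD perD]]]].
    by exists set0, fset0; split.
  have [SM|SM] := eqVneq #|`S| M; last first.
    exists D, L; split=> // T; rewrite inE => /orP[/eqP -> TM|//]; last exact: perD.
    by rewrite TM eqxx in SM.
  have [[W WD] _] := gD.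
  have S0 : S != fset0 by rewrite -cardfs_gt0 SM.
  have [L' hL'] := pent_hide_periodic Fol subX factor_pi WD S0.
  exists (D `|` periodic S L'), (L `|` L')%fset; split.
    apply: (step D _ (lnn R #|A|.+1 / #|`S|%:R)) => //; last by rewrite SM.
    by eexists; apply: windowedU WD (@windowed_periodic _ _ S L').
  move=> T; rewrite inE => /orP[/eqP -> _|TS TM].
    by apply: subset_trans (periodicW (fsubsetUr L L')) _; right.
  apply: subset_trans (periodicW (fsubsetUl L L')) _ => x px; left.
  exact: perD px.
pose L1 := (L `|` [fset 1%g])%fset.
have L11 : 1%g \in L1 by rewrite !inE eqxx orbT.
(* Cylinders over [L1] are added until they exhaust the full shift; keeping [D1] inside [D]
   preserves the inclusion of the periodic sets. *)
have [D2 gD2 D2all] : exists2 D, good D & forall x, D x.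
  suff [D [gD _ allD]] : exists D, [/\ good D, D1 `<=` D &
      forall p x, p \in enum {ffun L1 -> A} -> pat L1 x = p -> D x].
    by exists D => // x; apply: (allD (pat L1 x)); rewrite ?mem_enum.
  elim: (enum _) => [|p ps [D [gD D1D psD]]]; first by exists D1; split.
  have [[x0 px0]|nex] := pselect (exists x0 : full_shift G A, pat L1 x0 = p);
      last first.
    exists D; split=> // q x; rewrite inE => /orP[/eqP -> px|qps]; last exact: psD.
    by case: nex; exists x.
  have [[W WD] _] := gD; exists (D `|` [set x | agree L1 x0 x]); split.
  - apply: (step D _ (lnn R (#|`K|.+1 ^ M) / #|`K|%:R)) => //.
      eexists; apply: windowedU WD (_ : windowed L1 _).
      by move=> x y xy x0x; apply: agree_trans xy.
    apply: (pent_hide_cylinder Fol subX factor_pi x0 WD) => // S SK SM.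
    apply: subset_trans (periodicW (fsubsetUl L [fset 1%g]%fset)) _.
    exact: subset_trans (perD1 S SK SM) D1D.
  - by move=> x D1x; left; apply: D1D.
  - move=> q x; rewrite inE => /orP[/eqP -> xp|qps xq].
      by right; apply/pat_eqP; rewrite px0.
    by left; apply: psD qps xq.
have DT : D2 = setT by apply/seteqP; split=> x _ //; apply: D2all.
have [_] := gD2; rewrite DT; have := pent_hideT Fol subX subY factor_pi; lra.
Qed.

(** Amenability is expressed by the sequence [F]. For a finite group [H] would be a finite set,
    which cannot be dense in a nondegenerate interval; hence [infG]. The inclusion of [H] in [I] is
    monotonicity of entropy under factor maps. *)
Theorem theorem1p2 (R : realType) (G : groupType)
    (countG : countable [set: G]) (infG : infinite_set [set: G])
    (F : nat -> {fset G}) (folnerF : folner R F)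
    (A B : finType)
    (X : set (full_shift G A)) (Y : set (full_shift G B))
    (subX : subshift X) (subY : subshift Y)
    (pi : full_shift G A -> full_shift G B) (factor_pi : factor_map X Y pi) :
  let H := intermediate_entropies (R := R) F X Y pi in
  let I := [set r : R | (entropy R F Y <= r%:E <= entropy R F X)%E] in
  H `<=` I /\ I `<=` closure H.
Proof.
split=> [r [C [Z [phi [psi [subZ hZ fphi fpsi _]]]]]|r].
  move: hZ; rewrite /= !entropyE// => -[<-]; rewrite !lee_fin.
  rewrite (pent_factor folnerF subZ subY fpsi).
  by rewrite (pent_factor folnerF subX subZ fphi).
rewrite /= !entropyE// !lee_fin => hr V /nbhs_ballP [e /= e0 eV].
have [D [W WD] hD] :=
  subset_closure_hide infG folnerF subX subY factor_pi e0 hr.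
exists (pent R F (hide pi D @` X)); split; last exact: eV.
exact: hide_intermediate WD.
Qed.
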